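(* Let $P=(\Sigma,R)$ be a TSS in the tyft/tyxt format with recursion. Then bisimilarity $\equiv_B$ is a full congruence, i.e. it is an equivalence relation on $\mathrm{T}(\Sigma)$ satisfying: (1) for every $(f,n)\in\Sigma$ and closed terms $p_i,q_i$ with $p_i\equiv_B q_i$ for $i=1,\dots,n$, $f(p_1,\dots,p_n)\equiv_B f(q_1,\dots,q_n)$; and (2) for all $W\subseteq\mathrm{Var}$, $X\in W$, and recursive specifications $S,S':W\to\mathbb{T}(\Sigma,W)$, if $S_Y[\sigma]\equiv_B S'_Y[\sigma]$ for all $Y\in W$ and all $\sigma:W\to\mathrm{T}(\Sigma)$, then $\langle X|S\rangle\equiv_B\langle X|S'\rangle$.
   Context: Terms with recursion $\mathbb{T}(\Sigma)$ over $\Sigma$: variables, $f(t_1,\dots,t_n)$ for $(f,n)\in\Sigma$, and $\langle X|S\rangle$ for $S:V_S\to\mathbb{T}(\Sigma)$, $V_S\subseteq\mathrm{Var}$, $X\in V_S$ (binding $V_S$). $\mathbb{T}(\Sigma,W)$ = terms whose free variables lie in $W$; $\mathrm{T}(\Sigma)$ = closed terms. $t[\sigma]$ is capture-avoiding substitution of free variables. Literals $t\xrightarrow{a}t'$; rules $\frac{H}{\alpha}$ with $H$ a set of positive literals; TSS $P=(\Sigma,R)$; $P\vdash p\xrightarrow{a}q$ for closed $p,q$ means there is a well-founded proof tree with root $p\xrightarrow{a}q$ in which each node with children labels $K$ and label $\beta$ has $\frac{K}{\beta}$ a substitution instance of a rule in $R$. A bisimulation is a symmetric relation $\mathcal{R}\subseteq\mathrm{T}(\Sigma)\times\mathrm{T}(\Sigma)$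 such that $p\mathcal{R}q$ and $P\vdash p\xrightarrow{a}p'$ imply some $q'$ with $P\vdash q\xrightarrow{a}q'$ and $p'\mathcal{R}q'$; $p\equiv_B q$ iff some bisimulation relates them. tyft/tyxt format with recursion: for every recursive specification $S$, $X\in V_S$, $a\in A$ the TSS contains the rule $\frac{\langle S_X|S\rangle\xrightarrow{a}z}{\langle X|S\rangle\xrightarrow{a}z}$ where $\langle t|S\rangle$ abbreviates $t[\langle Y|S\rangle/Y]_{Y\in V_S}$; all other rules have only positive premises whose right-hand sides are distinct variables not occurring in the source, and the source is either a variable (tyxt) or contains exactly one function symbol and no repeated variables (tyft). *)

(* Defs.v *)
From Stdlib Require Import List.
Import ListNotations.
Set Implicit Arguments.

Definition Var := nat.

(* Terms over a signature whose function symbols have type F (arity given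
   separately by ar : F -> nat).  A recursive specification S : V_S -> T(Sigma)
   is encoded as a partial map  Var -> option term ; V_S = {Y | S Y <> None}. *)
Inductive term (F : Type) : Type :=
| tvar : Var -> term F
| tapp : F -> list (term F) -> term F
| trec : Var -> (Var -> option (term F)) -> term F.
Arguments tvar {F}.

Section Terms.
Variable F : Type.
Variable ar : F -> nat.

Definition inV (S : Var -> option (term F)) (Y : Var) : Prop := S Y <> None.

Inductive wf : term F -> Prop :=
| wf_var x : wf (tvar x)
| wf_app f ts : length ts = ar f -> (forall t, In t ts -> wf t) -> wf (tapp f ts)
| wf_rec X S : inV S X -> (forall Y t, S Y = Some t -> wf t) -> wf (trec X S).

Inductive free (x : Var) : term F -> Prop :=
| free_var : free x (tvar x)
| free_app f ts t : In t ts -> free x t -> free x (tapp f ts)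
| free_rec X S Y t : S Y = Some t -> free x t -> S x = None -> free x (trec X S).

Definition closed (t : term F) : Prop := wf t /\ forall x, ~ free x t.

(* Substitution of free variables.  Bound variables are shadowed.  It is
   capture-avoiding whenever the substituted terms are closed, which is the
   only way it is used below. *)
Fixpoint subst (t : term F) (sg : Var -> term F) {struct t} : term F :=
  match t with
  | tvar x => sg x
  | tapp f ts => tapp f (map (fun u => subst u sg) ts)
  | trec X Sp =>
      trec X (fun Y => match Sp Y with
                       | Some u => Some (subst u (fun Z => match Sp Z with
                                                           | Some _ => tvar Z
                                                           | None => sg Z end))
                       | None => None end)
  end.

Definition recsub (S : Var -> option (term F)) : Var -> term F :=
  fun Y => match S Y with Some _ => trec Y S | None => tvar Y end.

End Terms.

Definition lit (F A : Type) : Type := (term F * A * term F)%type.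

Record rule (F A : Type) : Type := mkRule {
  prem : lit F A -> Prop;
  concl : lit F A }.

Section TSS.
Variables (F A : Type) (ar : F -> nat).

Definition tyft_tyxt (r : rule F A) : Prop :=
  let '(src, _, tgt) := concl r in
  wf ar src /\ wf ar tgt /\
  (forall s a t, prem r (s, a, t) -> wf ar s /\ wf ar t) /\
  (forall s a t, prem r (s, a, t) -> exists y, t = tvar y /\ ~ free y src) /\
  (forall l1 l2, prem r l1 -> prem r l2 -> snd l1 = snd l2 -> l1 = l2) /\
  ((exists x, src = tvar x) \/
   (exists f xs, length xs = ar f /\ NoDup xs /\ src = tapp f (map tvar xs))).

(* Provability P |- p --a--> q for closed p, q, where P = (Sigma, R u Rec),
   R the given rules and Rec the recursion rules
     <S_X|S> --a--> z  /  <X|S> --a--> z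
   for every recursive specification S, X in V_S, a in A.  Proof trees are
   well-founded, i.e. provability is the inductive closure; nodes are closed
   substitution instances of rules. *)
Inductive proves (R : rule F A -> Prop) : term F -> A -> term F -> Prop :=
| pr_rule r (sg : Var -> term F) s a t :
    R r -> (forall x, closed ar (sg x)) -> concl r = (s, a, t) ->
    (forall s' a' t', prem r (s', a', t') ->
       proves R (subst s' sg) a' (subst t' sg)) ->
    proves R (subst s sg) a (subst t sg)
| pr_rec X S tX a q :
    closed ar (trec X S) -> S X = Some tX ->
    proves R (subst tX (recsub S)) a q ->
    proves R (trec X S) a q.

Definition bisimulation (R : rule F A -> Prop) (B : term F -> term F -> Prop) : Prop :=
  (forall p q, B p q -> closed ar p /\ closed ar q) /\
  (forall p q, B p q -> B q p) /\
  (forall p q a p', B p q -> proves R p a p' ->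
     exists q', proves R q a q' /\ B p' q').

Definition bisimilar (R : rule F A -> Prop) (p q : term F) : Prop :=
  exists B, bisimulation R B /\ B p q.

End TSS.

(* Main.v *)
(** Call [t] a lift of [p] if [t] is [p] with some closed subterms [p'] replaced by
    atoms [q], where [(p', q)] lies in a relation [U]; substituting the labels for the
    atoms gives the right projection [pr2 t].  Each transition [p --a--> p'] is
    lifted, by induction on its proof, to a function [L] from lifts of [p] to lifts
    of [p'] with [pr2 t --a--> pr2 (L t)].  The premises of a tyft/tyxt rule need not
    be well-founded, so the lifted substitution has to solve a possibly cyclic system of
    equations.  To solve it, order lifts of a fixed term by "more subterms replaced",
    where only atom-free subterms may be replaced; terms being well-founded, this
    order is chain-complete, and keeping every [L] monotone makes the system solvable
    by a least fixed point.

    With [U] bisimilarity, this shows that replacing closed subterms by bisimilar ones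
    preserves bisimilarity.  For [<X|S>] and [<X|S'>], one takes for [U] the closure of
    the pairs [(<Y|S>, <Y|S'>)] under contexts and under bisimilarity on the right: a
    transition of [S_Y[<Z|S>/Z]] lifts to one of [S_Y[<Z|S'>/Z]], which is matched by
    [S'_Y[<Z|S'>/Z]] and hence by [<Y|S'>]. *)

Require Import Defs.
From Stdlib Require Import List Classical ClassicalEpsilon FunctionalExtensionality.
Import ListNotations.
Set Implicit Arguments.

(** * Partial functions on the naturals: the common form of argument lists and recursive
    specifications *)

Definition same_dom (A B : Type) (P : nat -> option A) (T : nat -> option B) : Prop :=
  forall i, P i = None <-> T i = None.

Definition pointwise (A B : Type) (r : A -> B -> Prop)
  (P : nat -> option A) (T : nat -> option B) : Prop :=
  forall i p t, P i = Some p -> T i = Some t -> r p t.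

Lemma same_dom_some (A B : Type) (P : nat -> option A) (T : nat -> option B) i p :
  same_dom P T -> P i = Some p -> exists t, T i = Some t.
Proof.
  intros H E. destruct (T i) as [t|] eqn:Et; [eauto|].
  apply H in Et. congruence.
Qed.

Lemma same_dom_sym (A B : Type) (P : nat -> option A) (T : nat -> option B) :
  same_dom P T -> same_dom T P.
Proof. intros H i. specialize (H i). tauto. Qed.

Lemma same_dom_trans (A B C : Type) (P : nat -> option A) (T : nat -> option B)
  (Q : nat -> option C) :
  same_dom P T -> same_dom T Q -> same_dom P Q.
Proof. intros H K i. specialize (H i). specialize (K i). tauto. Qed.

Lemma same_dom_refl (A : Type) (P : nat -> option A) : same_dom P P.
Proof. intros i. tauto. Qed.

Lemma same_dom_option_map (A B : Type) (f : A -> B) (P : nat -> option A) :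
  same_dom P (fun i => option_map f (P i)).
Proof. intros i. destruct (P i); simpl; split; congruence. Qed.

Lemma same_dom_map (A B : Type) (f : A -> B) (l : list A) :
  same_dom (nth_error l) (nth_error (map f l)).
Proof. intros i. rewrite nth_error_map. destruct (nth_error l i); simpl; split; congruence. Qed.

Lemma same_dom_length (A B : Type) (l : list A) (l' : list B) :
  same_dom (nth_error l) (nth_error l') <-> length l = length l'.
Proof.
  split.
  - intros H. apply PeanoNat.Nat.le_antisymm.
    + apply nth_error_None. apply H. apply nth_error_None. apply le_n.
    + apply nth_error_None. apply H. apply nth_error_None. apply le_n.
  - intros E i. rewrite !nth_error_None, E. tauto.
Qed.

(** Choice along a partial function; it selects lifts or middle terms for all arguments, or all
    equations of a specification, at once. *)
Lemma option_fun_choice (A B : Type) (P : nat -> option A) (r : nat -> A -> B -> Prop) :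
  (forall i p, P i = Some p -> exists t, r i p t) ->
  exists T, same_dom P T /\ forall i p t, P i = Some p -> T i = Some t -> r i p t.
Proof.
  intros H.
  exists (fun i => match P i as o return P i = o -> option B with
    | Some p => fun e => Some (proj1_sig (constructive_indefinite_description _ (H i p e)))
    | None => fun _ => None end eq_refl).
  (* [P i] occurs in the type of the branches, so it is generalised to [o] before the case
     distinction. *)
  assert (G : forall i o (e : P i = o),
    (o = None <-> match o as o return P i = o -> option B with
    | Some p => fun e => Some (proj1_sig (constructive_indefinite_description _ (H i p e)))
    | None => fun _ => None end e = None) /\
    forall p t, o = Some p -> match o as o return P i = o -> option B with
    | Some p => fun e => Some (proj1_sig (constructive_indefinite_description _ (H i p e)))
    | None => fun _ => None end e = Some t -> r i p t).
  { intros i [p|] e; split.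
    - split; congruence.
    - intros p' t E E'. injection E as <-. injection E' as <-.
      apply (proj2_sig (constructive_indefinite_description _ (H i p e))).
    - tauto.
    - congruence. }
  split.
  - intros i. apply G.
  - intros i. apply G.
Qed.

(** Turns a partial function chosen along [nth_error l] back into an argument list. *)
Lemma list_of_fun (A B : Type) (l : list A) (G : nat -> option B) :
  same_dom (nth_error l) G -> exists l', nth_error l' = G.
Proof.
  intros H.
  enough (E : exists l', forall i, nth_error l' i = G i).
  { destruct E as [l' E]. exists l'. apply functional_extensionality, E. }
  revert G H. induction l as [|a l IH]; intros G H.
  - exists []. intros i. symmetry. destruct i; apply H; reflexivity.
  - destruct (IH (fun i => G (S i))) as [l' E'].
    { intros i. apply (H (S i)). }
    destruct (G 0) as [b|] eqn:E0.
    + exists (b :: l'). intros [|i]; simpl; auto.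
    + apply H in E0. discriminate.
Qed.

Lemma nth_error_inj (A : Type) (l l' : list A) :
  nth_error l = nth_error l' -> l = l'.
Proof. intros E. apply nth_error_ext. intros i. now rewrite E. Qed.

Lemma Forall2_in_l (A B : Type) (r : A -> B -> Prop) l l' a :
  Forall2 r l l' -> In a l -> exists b, In b l' /\ r a b.
Proof.
  induction 1 as [|x y l l' Hr H IH]; simpl; [tauto|].
  intros [<-|Ha]; [eauto|]. destruct (IH Ha) as (b & Hb & K). eauto.
Qed.

Lemma option_fun_ext (A : Type) (P T : nat -> option A) :
  same_dom P T -> pointwise eq P T -> P = T.
Proof.
  intros H K. apply functional_extensionality. intros i.
  destruct (P i) as [p|] eqn:E.
  - destruct (same_dom_some _ H E) as [t Et]. rewrite Et. f_equal. exact (K _ _ _ E Et).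
  - symmetry. now apply H.
Qed.

(** * Least fixed points in chain-complete posets *)

Section LeastFixedPoint.
Variables (X : Type) (D : X -> Prop) (le : X -> X -> Prop) (f : X -> X).
Hypothesis le_refl : forall x, D x -> le x x.
Hypothesis le_trans : forall x y z, le x y -> le y z -> le x z.
Hypothesis le_antisym : forall x y, le x y -> le y x -> x = y.
Hypothesis fD : forall x, D x -> D (f x).
Hypothesis fmono : forall x y, D x -> D y -> le x y -> le (f x) (f y).

Definition chain (C : X -> Prop) : Prop :=
  forall x y, C x -> C y -> le x y \/ le y x.
Definition lub (C : X -> Prop) (m : X) : Prop :=
  D m /\ (forall x, C x -> le x m) /\
  (forall b, D b -> (forall x, C x -> le x b) -> le m b).

Hypothesis complete : forall C : X -> Prop, (forall x, C x -> D x) -> chain C -> exists m, lub C m.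

(** The transfinite iterates of [f], generated without ordinals; they start at the bottom, which is
    the lub of the empty chain. *)
Inductive tower : X -> Prop :=
| tower_step x : tower x -> tower (f x)
| tower_lub C m : (forall x, C x -> tower x) -> lub C m -> tower m.

Lemma tower_D x : tower x -> D x.
Proof. induction 1; auto. apply H1. Qed.

(** The source of leastness in [least_fixed_point]. *)
Lemma tower_below b : D b -> le (f b) b -> forall x, tower x -> le x b.
Proof.
  intros Db Hb x T. induction T as [x T IH|C m HT IH L].
  - apply le_trans with (f b); auto. apply fmono; auto. now apply tower_D.
  - apply L; auto.
Qed.

Lemma tower_inflationary x : tower x -> le x (f x).
Proof.
  induction 1 as [x T IH|C m HT IH L].
  - pose proof (tower_D T). apply fmono; auto.
  - destruct L as (Dm & U & L). apply L; auto. intros x Cx.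
    apply le_trans with (f x); auto. apply fmono; auto.
    apply tower_D; auto.
Qed.

(** First half of the Bourbaki-Witt argument that the tower is a chain. The premise on [e] says that
    no iteration step jumps over [e]. *)
Lemma tower_split e :
  tower e -> (forall x, tower x -> le x e -> x <> e -> le (f x) e) ->
  forall x, tower x -> le x e \/ le (f e) x.
Proof.
  intros Te He x T. induction T as [x T IH|C m HT IH L].
  - destruct IH as [IH|IH].
    + destruct (classic (x = e)) as [->|N].
      * right. apply le_refl. apply fD, tower_D, Te.
      * left. auto.
    + right. apply le_trans with x; auto. now apply tower_inflationary.
  - destruct (classic (exists x, C x /\ le (f e) x)) as [[x [Cx Hx]]|N].
    + right. apply le_trans with x; auto. now apply L.
    + left. apply L. now apply tower_D. intros x Cx.
      destruct (IH x Cx); auto. exfalso; eauto.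
Qed.

(** Second half: the premise of [tower_split] holds at every [e], by induction on [e]. *)
Lemma tower_extreme e : tower e -> forall x, tower x -> le x e -> x <> e -> le (f x) e.
Proof.
  induction 1 as [e T IH|C m HT IH L]; intros x Tx Hx N.
  - destruct (tower_split T IH Tx) as [K|K].
    + apply fmono; auto using tower_D.
    + destruct N. now apply le_antisym.
  (* Either some member of [C] is not below [x], and its induction hypothesis applies, or [x] bounds
     [C] and equals [m]. *)
  - destruct (classic (exists c, C c /\ ~ le c x)) as [[c [Cc Hc]]|E].
    + destruct (tower_split (HT c Cc) (IH c Cc) Tx) as [K|K].
      * assert (x <> c) as Nc by (intros ->; apply Hc, le_refl, tower_D; auto).
        apply le_trans with c; [auto|now apply L].
      * destruct Hc. apply le_trans with (f c); auto.
        apply tower_inflationary; auto.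
    + destruct N. apply le_antisym; auto. apply L; auto using tower_D.
      intros c Cc. apply NNPP. intros Hc. eauto.
Qed.

Lemma least_fixed_point :
  exists m, D m /\ f m = m /\ forall b, D b -> le (f b) b -> le m b.
Proof.
  destruct (complete (C := tower)) as [m L].
  - exact tower_D.
  - intros x y Tx Ty. destruct (tower_split Tx (tower_extreme Tx) Ty); auto.
    left. apply le_trans with (f x); auto. now apply tower_inflationary.
  (* The lub of the tower is itself an iterate, hence the greatest one, so [f m] cannot exceed
     it. *)
  - assert (Tm : tower m) by (apply tower_lub with tower; auto).
    exists m. split; [now apply tower_D|]. split.
    + apply le_antisym. apply L. now apply tower_step. now apply tower_inflationary.
    + intros b Db Hb. apply L; auto. now apply tower_below.
Qed.

End LeastFixedPoint.

(** * Terms and substitution *)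

Section TermFacts.
Variable F : Type.
Variable ar : F -> nat.

(** An induction principle that reaches the subterms inside argument lists and recursive
    specifications. *)
Lemma term_nested_ind (P : term F -> Prop) :
  (forall x, P (tvar x)) ->
  (forall f ts, (forall i t, nth_error ts i = Some t -> P t) -> P (tapp f ts)) ->
  (forall X S, (forall Y t, S Y = Some t -> P t) -> P (trec X S)) ->
  forall t, P t.
Proof.
  intros Hv Ha Hr. fix IH 1. intros [x|f ts|X S].
  - apply Hv.
  - apply Ha. induction ts as [|u ts IHts]; intros [|i] t E; simpl in E; try discriminate.
    + injection E as <-. apply IH.
    + exact (IHts i t E).
  - apply Hr. intros Y t.
    (* Matching on [S Y] itself lets the guard checker see [u] as a subterm of the specification. *)
    refine (match S Y as o return o = Some t -> P t with
            | Some u => fun e => _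
            | None => fun e => _ end).
    + injection e as <-. apply IH.
    + discriminate e.
Qed.

Lemma wf_subst (t : term F) : forall sg,
  wf ar t -> (forall x, wf ar (sg x)) -> wf ar (subst t sg).
Proof.
  intros sg H. revert sg. induction H as [x|f ts E H IH|X S HX H IH]; intros sg Hs; simpl.
  - auto.
  - constructor.
    + now rewrite length_map.
    + intros t Ht. apply in_map_iff in Ht. destruct Ht as (u & <- & Hu). auto.
  - constructor.
    + unfold inV in *. destruct (S X); congruence.
    + intros Y t. destruct (S Y) as [u|] eqn:EY; [|discriminate].
      intros E. injection E as <-. apply IH with Y; auto.
      intros x. destruct (S x); auto. constructor.
Qed.

Lemma free_subst (t : term F) : forall sg y,
  free y (subst t sg) -> exists x, free x t /\ free y (sg x).
Proof.
  induction t as [x|f ts IH|X S IH] using term_nested_ind; intros sg y H; simpl in H.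
  - exists x. split; [constructor|auto].
  - inversion H as [|f' us u Hu Hy|]; subst. apply in_map_iff in Hu.
    destruct Hu as (t & <- & Ht). destruct (In_nth_error _ _ Ht) as [i Ei].
    destruct (IH i t Ei sg y Hy) as (x & Hx & Hyx). exists x. split; auto.
    now apply free_app with t.
  - inversion H as [| |X' S' Y u HY Hy HN]; subst.
    destruct (S Y) as [t|] eqn:EY; [|discriminate]. injection HY as <-.
    destruct (IH _ _ EY _ _ Hy) as (x & Hx & Hyx).
    destruct (S x) eqn:Ex.
    + inversion Hyx; subst. rewrite Ex in HN. discriminate.
    + exists x. split; auto. now apply free_rec with Y t.
Qed.

Lemma closed_subst (t : term F) sg :
  wf ar t -> (forall x, closed ar (sg x)) -> closed ar (subst t sg).
Proof.
  intros H Hs. split.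
  - apply wf_subst; auto. apply Hs.
  - intros y Hy. destruct (free_subst _ _ Hy) as (x & _ & Hx). now apply Hs in Hx.
Qed.

Lemma subst_no_free (t : term F) : forall sg,
  (forall x, free x t -> sg x = tvar x) -> subst t sg = t.
Proof.
  induction t as [x|f ts IH|X S IH] using term_nested_ind; intros sg H; simpl.
  - apply H. constructor.
  - f_equal. rewrite <- (map_id ts) at 2. apply map_ext_in. intros t Ht.
    destruct (In_nth_error _ _ Ht) as [i Ei]. apply (IH i); auto.
    intros x Hx. apply H. now apply free_app with t.
  - f_equal. apply functional_extensionality. intros Y.
    destruct (S Y) as [t|] eqn:EY; auto. f_equal. apply (IH Y); auto.
    intros x Hx. destruct (S x) eqn:Ex; auto. apply H. now apply free_rec with Y t.
Qed.

Lemma subst_closed (t : term F) sg : closed ar t -> subst t sg = t.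
Proof. intros [_ H]. apply subst_no_free. intros x Hx. now apply H in Hx. Qed.

End TermFacts.

(** * Lifted terms *)

Section Lift.
Variables (F : Type) (ar : F -> nat).

Notation lterm := (term (F + term F)).
(** A constant of an enlarged signature: lifted terms are then ordinary terms, and substitution does
    not enter the content of an atom. *)
Definition atom (q : term F) : lterm := tapp (inr q) [].

Fixpoint emb (t : term F) : lterm :=
  match t with
  | tvar x => tvar x
  | tapp f ts => tapp (inl f) (map emb ts)
  | trec X Sp => trec X (fun Y => option_map emb (Sp Y))
  end.

Fixpoint pr2 (t : lterm) : term F :=
  match t with
  | tvar x => tvar x
  | tapp (inl f) ts => tapp f (map pr2 ts)
  | tapp (inr q) _ => q
  | trec X Sp => trec X (fun Y => option_map pr2 (Sp Y))
  end.

(* [lift U p t]: the term [t] projects to [p] on the left and to [pr2 t] on the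
   right, where an atom [q] stands for a pair [(p', q)] in [U]. *)
Inductive lift (U : term F -> term F -> Prop) : term F -> lterm -> Prop :=
| lift_var x : lift U (tvar x) (tvar x)
| lift_app f ps ts :
    same_dom (nth_error ps) (nth_error ts) ->
    (forall i p t, nth_error ps i = Some p -> nth_error ts i = Some t -> lift U p t) ->
    lift U (tapp f ps) (tapp (inl f) ts)
| lift_rec X P T :
    same_dom P T ->
    (forall i p t, P i = Some p -> T i = Some t -> lift U p t) ->
    lift U (trec X P) (trec X T)
| lift_atom p q : U p q -> lift U p (atom q).

(* [t'] arises from [t] by replacing closed subterms without atoms by atoms. *)
Inductive le : lterm -> lterm -> Prop :=
| le_var x : le (tvar x) (tvar x)
| le_app f ts ts' :
    same_dom (nth_error ts) (nth_error ts') ->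
    (forall i t t', nth_error ts i = Some t -> nth_error ts' i = Some t' -> le t t') ->
    le (tapp (inl f) ts) (tapp (inl f) ts')
| le_rec X T T' :
    same_dom T T' ->
    (forall i t t', T i = Some t -> T' i = Some t' -> le t t') ->
    le (trec X T) (trec X T')
| le_atom q : le (atom q) (atom q)
| le_emb_atom t p q : t = emb p -> closed ar p -> le t (atom q).

Lemma pr2_emb (p : term F) : pr2 (emb p) = p.
Proof.
  induction p as [x|f ts IH|X S IH] using term_nested_ind; simpl; auto.
  - f_equal. rewrite map_map. rewrite <- (map_id ts) at 2. apply map_ext_in.
    intros t Ht. destruct (In_nth_error _ _ Ht) as [i Ei]. now apply (IH i).
  - f_equal. apply functional_extensionality. intros Y.
    destruct (S Y) as [t|] eqn:E; simpl; auto. f_equal. now apply (IH Y).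
Qed.

Lemma free_emb x (p : term F) : free x (emb p) -> free x p.
Proof.
  induction p as [y|f ts IH|X S IH] using term_nested_ind; simpl; intros H.
  - inversion H. constructor.
  - inversion H as [|f' us u Hu Hx|]; subst. apply in_map_iff in Hu.
    destruct Hu as (t & <- & Ht). destruct (In_nth_error _ _ Ht) as [i Ei].
    apply free_app with t; auto. now apply (IH i).
  - inversion H as [| |X' S' Y u HY Hx HN]; subst.
    destruct (S Y) as [t|] eqn:E; [|discriminate]. injection HY as <-.
    apply free_rec with Y t; auto. now apply (IH Y).
    destruct (S x); [discriminate|auto].
Qed.

Lemma subst_emb_closed (p : term F) sg : closed ar p -> subst (emb p) sg = emb p.
Proof.
  intros [_ H]. apply subst_no_free. intros x Hx. apply free_emb in Hx. now apply H in Hx.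
Qed.

Lemma emb_subst (p : term F) : forall sg,
  subst (emb p) (fun x => emb (sg x)) = emb (subst p sg).
Proof.
  induction p as [y|f ts IH|X S IH] using term_nested_ind; simpl; intros sg; auto.
  - f_equal. rewrite !map_map. apply map_ext_in. intros t Ht.
    destruct (In_nth_error _ _ Ht) as [i Ei]. now apply (IH i).
  - f_equal. apply functional_extensionality. intros Y.
    destruct (S Y) as [t|] eqn:E; simpl; auto. f_equal. rewrite <- (IH Y t E).
    f_equal. apply functional_extensionality. intros Z. now destruct (S Z).
Qed.

Lemma emb_recsub (S : Var -> option (term F)) :
  (fun x => emb (recsub S x)) = recsub (fun Y => option_map emb (S Y)).
Proof.
  apply functional_extensionality. intros Y. unfold recsub. now destruct (S Y).
Qed.

Lemma lift_emb U (p : term F) : lift U p (emb p).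
Proof.
  induction p as [y|f ts IH|X S IH] using term_nested_ind; simpl; constructor.
  - apply same_dom_map.
  - intros i p t E E'. rewrite nth_error_map, E in E'. injection E' as <-. now apply (IH i).
  - apply same_dom_option_map.
  - intros i p t E E'. rewrite E in E'. injection E' as <-. now apply (IH i).
Qed.

(* Transparent: the guard checker unfolds it in [rec_sim_nested_ind]. *)
Lemma lift_mono (U V : term F -> term F -> Prop) p t :
  (forall p q, U p q -> V p q) -> lift U p t -> lift V p t.
Proof. intros H. induction 1; constructor; auto. Defined.

Lemma emb_not_atom p q : emb p <> atom q.
Proof. destruct p; discriminate. Qed.

(** Moving up creates atoms and removes none, so an atom-free term is minimal. *)
Lemma le_emb_inv t p : le t (emb p) -> t = emb p.
Proof.
  intros H. remember (emb p) as u eqn:E. revert p E.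
  induction H as [x|f ts ts' D H IH|X T T' D H IH|q|t p' q Ht Hc]; intros p E; auto.
  - f_equal. apply nth_error_inj, option_fun_ext; auto.
    intros i t t' Et Et'. destruct p as [|g ps|]; try discriminate.
    injection E as -> ->. pose proof Et' as Ep.
    rewrite nth_error_map in Ep. destruct (nth_error ps i) as [p|]; [|discriminate].
    injection Ep as <-. apply (IH i t _ Et Et' p); auto.
  - f_equal. apply option_fun_ext; auto.
    intros i t t' Et Et'. destruct p as [| |Y S]; try discriminate.
    injection E as -> ->. assert (exists p, t' = emb p) as [p Ep].
    { destruct (S i) as [p|]; [|discriminate]. injection Et' as <-. eauto. }
    apply (IH i t t' Et Et' p Ep).
  - symmetry in E. now apply emb_not_atom in E.
Qed.

(** Atoms are maximal, because only atom-free terms may be replaced. *)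
Lemma le_atom_inv t q : le (atom q) t -> t = atom q.
Proof.
  intros H. inversion H as [| | | |t' p' q' Ht]; subst; auto.
  symmetry in Ht. now apply emb_not_atom in Ht.
Qed.

(** If the second step replaces [t2] as a whole, then [t2] is atom-free, and [t1 = t2] by
    minimality. *)
Lemma le_trans t1 t2 t3 : le t1 t2 -> le t2 t3 -> le t1 t3.
Proof.
  intros H. revert t3.
  induction H as [x|f ts ts' D H IH|X T T' D H IH|q|t p' q Ht Hc]; intros t3 K; auto.
  - inversion K as [|f' us us' D' H'| | |t' p q Ht Hp]; subst.
    + constructor.
      * now apply same_dom_trans with (T := (nth_error ts')).
      * intros i t t' E E'. destruct (same_dom_some _ D E) as [u Eu].
        apply (IH i t u E Eu). eauto.
    + apply le_emb_atom with p; auto. apply le_emb_inv.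
      rewrite <- Ht. now constructor.
  - inversion K as [| |X' us us' D' H'| |t' p q Ht Hp]; subst.
    + constructor.
      * now apply same_dom_trans with (T := T').
      * intros i t t' E E'. destruct (same_dom_some _ D E) as [u Eu].
        apply (IH i t u E Eu). eauto.
    + apply le_emb_atom with p; auto. apply le_emb_inv.
      rewrite <- Ht. now constructor.
  - apply le_atom_inv in K. subst t3. now apply le_emb_atom with p'.
Qed.

Lemma le_antisym t t' : le t t' -> le t' t -> t = t'.
Proof.
  intros H.
  induction H as [x|f ts ts' D H IH|X T T' D H IH|q|t p' q Ht Hc]; intros K; auto.
  - f_equal. apply nth_error_inj, option_fun_ext; auto.
    intros i t t' E E'. apply (IH i); auto. inversion K; subst; eauto.
  - f_equal. apply option_fun_ext; auto.
    intros i t t' E E'. apply (IH i); auto. inversion K; subst; eauto.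
  - now apply le_atom_inv in K.
Qed.

(** A replaced subterm is closed, so substitution leaves it, and the replacement, intact. *)
Lemma le_subst t t' : le t t' -> forall sg sg',
  (forall x, le (sg x) (sg' x)) -> le (subst t sg) (subst t' sg').
Proof.
  induction 1 as [x|f ts ts' D H IH|X T T' D H IH|q|t p' q Ht Hc]; intros sg sg' Hs; simpl.
  - auto.
  - constructor.
    + apply same_dom_length. rewrite !length_map. now apply same_dom_length.
    + intros i u u' E E'. rewrite nth_error_map in E, E'.
      destruct (nth_error ts i) eqn:Et, (nth_error ts' i) eqn:Et'; try discriminate.
      injection E as <-. injection E' as <-. eauto.
  - constructor.
    + intros i. specialize (D i). destruct (T i), (T' i); split; try congruence;
      intros _; exfalso; intuition congruence.
    + intros i u u' E E'. destruct (T i) eqn:Et, (T' i) eqn:Et'; try discriminate.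
      injection E as <-. injection E' as <-. apply (IH i); auto.
      intros x. specialize (D x). destruct (T x), (T' x); auto; try constructor;
      exfalso; intuition congruence.
  - constructor.
  - subst t. rewrite (subst_emb_closed sg Hc). now apply le_emb_atom with p'.
Qed.

(** * Lifts along a relation between closed terms *)

Section Relation.
Variable U : term F -> term F -> Prop.
Hypothesis U_closed : forall p q, U p q -> closed ar p /\ closed ar q.

(** Reflexivity is claimed for lifts only: an [inr] symbol applied to a nonempty list is not related
    to itself. *)
Lemma le_refl p t : lift U p t -> le t t.
Proof.
  induction 1 as [x|f ps ts D H IH|X P T D H IH|p q HU].
  - constructor.
  - constructor. apply same_dom_refl. intros i t t' E E'. rewrite E in E'.
    injection E' as <-. destruct (same_dom_some _ (same_dom_sym D) E) as [p Ep]. eauto.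
  - constructor. apply same_dom_refl. intros i t t' E E'. rewrite E in E'.
    injection E' as <-. destruct (same_dom_some _ (same_dom_sym D) E) as [p Ep]. eauto.
  - constructor.
Qed.

(** Makes [emb p] the bottom of the lifts of [p]; left components of [U] are closed, so they may be
    replaced by atoms. *)
Lemma emb_le p t : lift U p t -> le (emb p) t.
Proof.
  induction 1 as [x|f ps ts D H IH|X P T D H IH|p q HU]; simpl.
  - constructor.
  - constructor.
    + apply same_dom_trans with (T := (nth_error ps)); auto. apply same_dom_sym, same_dom_map.
    + intros i t t' E E'. rewrite nth_error_map in E.
      destruct (nth_error ps i) eqn:Ep; [|discriminate]. injection E as <-. eauto.
  - constructor.
    + apply same_dom_trans with (T := P); auto. apply same_dom_sym, same_dom_option_map.
    + intros i t t' E E'. destruct (P i) eqn:Ep; [|discriminate]. injection E as <-. eauto.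
  - apply le_emb_atom with p; auto. now apply U_closed in HU.
Qed.

Lemma lift_subst p t : lift U p t -> forall sg sg',
  (forall x, lift U (sg x) (sg' x)) -> lift U (subst p sg) (subst t sg').
Proof.
  induction 1 as [x|f ts ts' D H IH|X T T' D H IH|p q HU]; intros sg sg' Hs; simpl.
  - auto.
  - constructor.
    + apply same_dom_length. rewrite !length_map. now apply same_dom_length.
    + intros i u u' E E'. rewrite nth_error_map in E, E'.
      destruct (nth_error ts i) eqn:Et, (nth_error ts' i) eqn:Et'; try discriminate.
      injection E as <-. injection E' as <-. eauto.
  - constructor.
    + intros i. specialize (D i). destruct (T i), (T' i); split; try congruence;
      intros _; exfalso; intuition congruence.
    + intros i u u' E E'. destruct (T i) eqn:Et, (T' i) eqn:Et'; try discriminate.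
      injection E as <-. injection E' as <-. apply (IH i); auto.
      intros x. specialize (D x). destruct (T x), (T' x); auto; try constructor;
      exfalso; intuition congruence.
  - rewrite (subst_closed sg (proj1 (U_closed HU))). now constructor.
Qed.

Lemma pr2_subst p t : lift U p t -> forall sg,
  pr2 (subst t sg) = subst (pr2 t) (fun x => pr2 (sg x)).
Proof.
  induction 1 as [x|f ps ts D H IH|X P T D H IH|p q HU]; intros sg; simpl.
  - auto.
  - f_equal. rewrite !map_map. apply map_ext_in. intros t Ht.
    destruct (In_nth_error _ _ Ht) as [i Ei].
    destruct (same_dom_some _ (same_dom_sym D) Ei) as [p Ep]. eauto.
  - f_equal. apply functional_extensionality. intros Y.
    destruct (T Y) as [t|] eqn:E; simpl; auto.
    destruct (same_dom_some _ (same_dom_sym D) E) as [p Ep]. f_equal.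
    rewrite (IH Y p t Ep E). f_equal. apply functional_extensionality. intros Z.
    now destruct (T Z).
  - symmetry. apply (subst_closed _ (proj2 (U_closed HU))).
Qed.

Lemma pr2_subst_emb p sg : pr2 (subst (emb p) sg) = subst p (fun x => pr2 (sg x)).
Proof. rewrite (pr2_subst (lift_emb U p)). now rewrite pr2_emb. Qed.

Lemma wf_pr2 p t : lift U p t -> wf ar p -> wf ar (pr2 t).
Proof.
  induction 1 as [x|f ps ts D H IH|X P T D H IH|p q HU]; intros W; simpl.
  - constructor.
  - inversion W as [|f' ps' E Hps|]; subst. constructor.
    + rewrite length_map, <- E. symmetry. now apply same_dom_length.
    + intros u Hu. apply in_map_iff in Hu. destruct Hu as (t & <- & Ht).
      destruct (In_nth_error _ _ Ht) as [i Ei].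
      destruct (same_dom_some _ (same_dom_sym D) Ei) as [p Ep].
      apply (IH i p t); auto. apply Hps. eapply nth_error_In; eauto.
  - inversion W as [| |X' S' HX HS]; subst. constructor.
    + unfold inV in *. specialize (D X). destruct (T X); simpl; [discriminate|].
      intuition congruence.
    + intros Y u E. destruct (T Y) as [t|] eqn:Et; [|discriminate]. injection E as <-.
      destruct (same_dom_some _ (same_dom_sym D) Et) as [p Ep].
      apply (IH Y p t); auto. eauto.
  - apply U_closed in HU. apply HU.
Qed.

Lemma free_pr2 x p t : lift U p t -> free x (pr2 t) -> free x p.
Proof.
  induction 1 as [y|f ps ts D H IH|X P T D H IH|p q HU]; simpl; intros Hx.
  - auto.
  - inversion Hx as [|f' us u Hu Hf|]; subst. apply in_map_iff in Hu.
    destruct Hu as (t & <- & Ht). destruct (In_nth_error _ _ Ht) as [i Ei].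
    destruct (same_dom_some _ (same_dom_sym D) Ei) as [p Ep].
    apply free_app with p; eauto. eapply nth_error_In; eauto.
  - inversion Hx as [| |X' S' Y u HY Hf HN]; subst.
    destruct (T Y) as [t|] eqn:Et; [|discriminate]. injection HY as <-.
    destruct (same_dom_some _ (same_dom_sym D) Et) as [p Ep].
    apply free_rec with Y p; eauto. apply D.
    destruct (T x); [discriminate|auto].
  - apply U_closed in HU. destruct HU as [_ [_ N]]. now apply N in Hx.
Qed.

Lemma closed_pr2 p t : lift U p t -> closed ar p -> closed ar (pr2 t).
Proof.
  intros H [W N]. split.
  - eapply wf_pr2; eauto.
  - intros x Hx. apply (N x). eapply free_pr2; eauto.
Qed.

(** Only atom-free terms lie strictly below an atom, and [emb p] is the only atom-free lift of
    [p]. *)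
Lemma lift_le_atom p t q : lift U p t -> le t (atom q) -> t = atom q \/ t = emb p.
Proof.
  intros H K. inversion K as [| | | |t' p' q' E Hp]; subst; auto.
  right. symmetry. apply le_emb_inv. now apply emb_le.
Qed.

(** Lubs of chains of families are taken component by component, for lists and specifications
    alike. *)
Lemma lub_pointwise (P : nat -> option (term F)) (C : (nat -> option lterm) -> Prop) :
  (forall i p, P i = Some p -> forall K, (forall t, K t -> lift U p t) ->
     chain le K -> exists m, lub (lift U p) le K m) ->
  (forall T, C T -> same_dom P T /\ pointwise (lift U) P T) ->
  (forall T T', C T -> C T' -> pointwise le T T' \/ pointwise le T' T) ->
  exists M, same_dom P M /\ pointwise (lift U) P M /\
    (forall T, C T -> pointwise le T M) /\
    (forall T, same_dom P T -> pointwise (lift U) P T ->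
       (forall T', C T' -> pointwise le T' T) -> pointwise le M T).
Proof.
  intros IH HC Hch.
  destruct (option_fun_choice P
    (fun i p m => lub (lift U p) le (fun t => exists T, C T /\ T i = Some t) m))
    as (M & HM & HL).
  { intros i p E. apply (IH i p E).
    - intros t (T & CT & ET). apply (HC T CT) with i; auto.
    - intros t t' (T & CT & ET) (T' & CT' & ET').
      destruct (Hch T T' CT CT') as [L|L]; [left|right]; eapply L; eauto. }
  exists M. repeat split.
  - apply HM.
  - apply HM.
  - intros i p m Ep Em. apply (HL i p m Ep Em).
  - intros T CT i t m Et Em.
    destruct (same_dom_some _ (same_dom_sym HM) Em) as [p Ep].
    apply (HL i p m Ep Em). eauto.
  - intros T D L B i m t Em Et.
    destruct (same_dom_some _ (same_dom_sym HM) Em) as [p Ep].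
    apply (HL i p m Ep Em); eauto.
    intros t' (T' & CT' & Et'). apply (B T' CT' i); auto.
Qed.

(** Disposes of the chains with an evident lub: those constantly [emb p], including the empty one,
    and those containing an atom, which is then the greatest member. *)
Lemma lub_cases p (C : lterm -> Prop) :
  (forall t, C t -> lift U p t) -> chain le C ->
  (~ (forall t, C t -> t = emb p) -> ~ (exists q, C (atom q)) ->
   exists m, lub (lift U p) le C m) ->
  exists m, lub (lift U p) le C m.
Proof.
  intros HC Hch H.
  destruct (classic (forall t, C t -> t = emb p)) as [Hpure|Hpure].
  { exists (emb p). split; [apply lift_emb|]. split.
    - intros t Ct. rewrite (Hpure t Ct). apply le_refl with p, lift_emb.
    - intros b Hb _. now apply emb_le. }
  destruct (classic (exists q, C (atom q))) as [[q Cq]|Hatom]; [|auto].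
  exists (atom q). split; [auto|]. split; [|auto].
  intros t Ct. destruct (Hch t (atom q) Ct Cq) as [K|K]; auto.
  apply le_atom_inv in K. subst t. constructor.
Qed.

(** In the chains left by [lub_cases] no member is an atom, so all members share the root of [p],
    and induction on [p] gives the lub componentwise. *)
Lemma lift_complete p : forall C, (forall t, C t -> lift U p t) -> chain le C ->
  exists m, lub (lift U p) le C m.
Proof.
  induction p as [x|f ps IH|X S IH] using term_nested_ind; intros C HC Hch.
  all: apply lub_cases; auto; intros Hpure Hatom.
  - destruct Hpure. intros t Ct. pose proof (HC t Ct) as K. inversion K; subst; auto.
    destruct Hatom. eauto.
  - assert (HC' : forall t, C t -> exists ts, t = tapp (inl f) ts /\
       same_dom (nth_error ps) (nth_error ts) /\
       pointwise (lift U) (nth_error ps) (nth_error ts)).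
    { intros t Ct. pose proof (HC t Ct) as K.
      inversion K as [|f' ps' ts D H| |]; subst; eauto. destruct Hatom. eauto. }
    destruct (@lub_pointwise (nth_error ps)
      (fun T => exists ts, T = nth_error ts /\ C (tapp (inl f) ts))) as (M & D & L & Ub & Lb).
    + intros i p E. apply (IH i p E).
    + intros T (ts & -> & Ct). destruct (HC' _ Ct) as (us & E & K).
      injection E as <-. exact K.
    + intros T T' (ts & -> & Ct) (ts' & -> & Ct').
      destruct (Hch _ _ Ct Ct') as [K|K]; [left|right]; inversion K; subst; auto.
    + destruct (list_of_fun _ D) as [ms <-]. exists (tapp (inl f) ms). split; [|split].
      * now constructor.
      * intros t Ct. destruct (HC' t Ct) as (ts & -> & K & _). constructor.
        -- apply same_dom_trans with (T := (nth_error ps)); auto using same_dom_sym.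
        -- apply Ub. eauto.
      * intros b Hb Hub. inversion Hb as [|f' ps' bs D' H'| |p' q Hq]; subst.
        -- constructor.
           ++ apply same_dom_trans with (T := (nth_error ps)); auto using same_dom_sym.
           ++ apply Lb; auto. intros T (ts & -> & Ct). apply Hub in Ct.
              inversion Ct; subst; auto.
        (* An atom above the whole chain would force every member to be atom-free, against
           [Hpure]. *)
        -- destruct Hpure. intros t Ct. destruct (HC' t Ct) as (ts & -> & K).
           destruct (lift_le_atom (HC _ Ct) (Hub _ Ct)) as [E|E]; [discriminate|auto].
  - assert (HC' : forall t, C t -> exists T, t = trec X T /\
       same_dom S T /\ pointwise (lift U) S T).
    { intros t Ct. pose proof (HC t Ct) as K.
      inversion K as [| |X' P T D H|]; subst; eauto. destruct Hatom. eauto. }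
    destruct (@lub_pointwise S (fun T => C (trec X T))) as (M & D & L & Ub & Lb).
    + intros i p E. apply (IH i p E).
    + intros T Ct. destruct (HC' _ Ct) as (us & E & K).
      injection E as <-. exact K.
    + intros T T' Ct Ct'.
      destruct (Hch _ _ Ct Ct') as [K|K]; [left|right]; inversion K; subst; auto.
    + exists (trec X M). split; [|split].
      * now constructor.
      * intros t Ct. destruct (HC' t Ct) as (T & -> & K & _). constructor.
        -- apply same_dom_trans with (T := S); auto using same_dom_sym.
        -- apply Ub. auto.
      * intros b Hb Hub. inversion Hb as [| |X' P B D' H'|p' q Hq]; subst.
        -- constructor.
           ++ apply same_dom_trans with (T := S); auto using same_dom_sym.
           ++ apply Lb; auto. intros T Ct. apply Hub in Ct.
              inversion Ct; subst; auto.
        -- destruct Hpure. intros t Ct. destruct (HC' t Ct) as (T & -> & K).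
           destruct (lift_le_atom (HC _ Ct) (Hub _ Ct)) as [E|E]; [discriminate|auto].
Qed.

End Relation.
End Lift.

Lemma fun_choice (A B : Type) (r : A -> B -> Prop) :
  (forall a, exists b, r a b) -> exists f, forall a, r a (f a).
Proof.
  intros H. exists (fun a => proj1_sig (constructive_indefinite_description _ (H a))).
  intros a. apply (proj2_sig (constructive_indefinite_description _ (H a))).
Qed.

(** * Lifting transitions *)

Section Transitions.
Variables (F A : Type) (ar : F -> nat) (R : rule F A -> Prop).
Hypothesis HR : forall r, R r -> tyft_tyxt ar r.
Notation lterm := (term (F + term F)).

Lemma proves_closed p a q : proves ar R p a q -> closed ar q.
Proof.
  induction 1 as [r sg s a t Hr Hsg E _ _|]; auto.
  apply closed_subst; auto. apply HR in Hr. unfold tyft_tyxt in Hr. rewrite E in Hr.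
  tauto.
Qed.

Variable U : term F -> term F -> Prop.
Hypothesis U_closed : forall p q, U p q -> closed ar p /\ closed ar q.

(** [N] restricts the lifts considered, so that atoms can be treated separately. The last clause
    preserves bottoms; monotonicity at atoms and the atom-free solution of the premises rely on
    it. *)
Definition lifting (N : lterm -> Prop) (p : term F) (a : A) (p' : term F)
  (L : lterm -> lterm) : Prop :=
  (forall t, N t -> lift U p t -> lift U p' (L t) /\ proves ar R (pr2 t) a (pr2 (L t))) /\
  (forall t t', N t -> N t' -> lift U p t -> lift U p t' -> le ar t t' ->
     le ar (L t) (L t')) /\
  L (emb p) = emb p'.

Definition any (t : lterm) : Prop := True.
Definition non_atomic (t : lterm) : Prop := forall q, t <> atom q.

Definition liftable N p a p' : Prop := exists L, lifting N p a p' L.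

Definition atom_step (p : term F) (a : A) (p' : term F) : Prop :=
  forall q, U p q -> exists t, lift U p' t /\ proves ar R q a (pr2 t).

(** Among the lifts of [p], only [emb p] lies strictly below an atom, and it is sent to the bottom
    [emb p']. Hence any values at atoms allowed by [atom_step] keep the lifting monotone. *)
Lemma liftable_combine p a p' :
  liftable non_atomic p a p' -> atom_step p a p' -> liftable any p a p'.
Proof.
  intros (L & H1 & H2 & H3) HA.
  destruct (@fun_choice (term F) lterm (fun q t => U p q ->
    lift U p' t /\ proves ar R q a (pr2 t))) as [f Hf].
  { intros q. destruct (classic (U p q)) as [Hq|Hq].
    - destruct (HA q Hq) as [t Ht]. eauto.
    (* A dummy value, as [q] is not paired with [p]. *)
    - exists (atom q). tauto. }
  set (L' := fun t : lterm => match t with tapp (inr q) [] => f q | _ => L t end).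
  assert (EL : forall t, non_atomic t -> L' t = L t).
  { intros [x|[g|q] [|u ts]|X S] Ht; auto. now destruct (Ht q). }
  assert (Hcase : forall t, non_atomic t \/ exists q, t = atom q).
  { intros t. destruct (classic (exists q, t = atom q)); auto.
    left. intros q E. eauto. }
  exists L'. split; [|split].
  - intros t _ Ht. destruct (Hcase t) as [Na|[q ->]].
    + rewrite (EL t Na). auto.
    + simpl. apply Hf. inversion Ht; auto.
  - intros t t' _ _ Ht Ht' Hle. destruct (Hcase t) as [Na|[q ->]].
    + rewrite (EL t Na). destruct (Hcase t') as [Na'|[q ->]].
      * rewrite (EL t' Na'). auto.
      * destruct (lift_le_atom U_closed Ht Hle) as [E|E]; [now destruct (Na q)|].
        subst t. rewrite H3. apply emb_le with (U := U); auto.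
        simpl. apply Hf. inversion Ht'; auto.
    + apply le_atom_inv in Hle. subst t'. apply le_refl with (U := U) (p := p').
      simpl. apply Hf. inversion Ht; auto.
  - rewrite EL; auto. intros q. apply emb_not_atom.
Qed.

(** * Lifted substitutions, and solutions of the premises of a rule *)

Definition lifts_assignment (rho : Var -> term F) (xh : Var -> lterm) : Prop :=
  forall x, lift U (rho x) (xh x).
Definition le_assignment (xh yh : Var -> lterm) : Prop := forall x, le ar (xh x) (yh x).

Lemma assignment_complete rho (C : (Var -> lterm) -> Prop) :
  (forall xh, C xh -> lifts_assignment rho xh) -> chain le_assignment C ->
  exists m, lub (lifts_assignment rho) le_assignment C m.
Proof.
  intros HC Hch.
  destruct (@fun_choice Var lterm (fun x m =>
    lub (lift U (rho x)) (le ar) (fun t => exists xh, C xh /\ t = xh x) m)) as [m Hm].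
  { intros x. apply lift_complete; auto.
    - intros t (xh & Cx & ->). now apply HC.
    - intros t t' (xh & Cx & ->) (yh & Cy & ->).
      destruct (Hch xh yh Cx Cy) as [K|K]; [left|right]; apply K. }
  exists m. split; [|split].
  - intros x. apply (Hm x).
  - intros xh Cx x. apply (Hm x). eauto.
  - intros b Db Hb x. apply (Hm x); auto. intros t (xh & Cx & ->). now apply Hb.
Qed.

(* The premises of a rule may depend on each other cyclically; monotonicity of
   the liftings lets us solve them simultaneously by a least fixed point. *)
Lemma solve_premises (Q : lit F A -> Prop) (rho : Var -> term F) :
  (forall s b t, Q (s, b, t) -> exists y, t = tvar y /\
     liftable any (subst s rho) b (rho y)) ->
  (forall l1 l2, Q l1 -> Q l2 -> snd l1 = snd l2 -> l1 = l2) ->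
  exists M : (Var -> lterm) -> Var -> lterm,
    (forall xh, lifts_assignment rho xh ->
       lifts_assignment rho (M xh) /\
       (forall y, (forall s b, ~ Q (s, b, tvar y)) -> M xh y = xh y) /\
       (forall s b y, Q (s, b, tvar y) ->
          proves ar R (subst s (fun x => pr2 (M xh x))) b (pr2 (M xh y)))) /\
    (forall xh xh', lifts_assignment rho xh -> lifts_assignment rho xh' ->
       le_assignment xh xh' -> le_assignment (M xh) (M xh')) /\
    M (fun x => emb (rho x)) = (fun x => emb (rho x)).
Proof.
  intros HQ Hd.
  (* [st y] gives the next value at [y]: by the lifting of the premise with target [y] if there is
     one, and otherwise the supplied value [d]. *)
  destruct (@fun_choice Var (lterm -> (Var -> lterm) -> lterm) (fun y st =>
    ((forall s b, ~ Q (s, b, tvar y)) /\ st = (fun d _ => d)) \/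
    (exists s b L, Q (s, b, tvar y) /\ lifting any (subst s rho) b (rho y) L /\
       st = (fun _ yh => L (subst (emb s) yh))))) as [st Hst].
  { intros y. destruct (classic (exists s b, Q (s, b, tvar y))) as [(s & b & q)|N].
    - destruct (HQ _ _ _ q) as (y' & E & L & HL). injection E as <-.
      exists (fun _ yh => L (subst (emb s) yh)). right. exists s, b, L. auto.
    - exists (fun d _ => d). left. split; auto. intros s b q. eauto. }
  (* [xh] is a parameter giving the values at variables that are no premise targets; [yh] is the
     argument to be iterated. *)
  set (Phi := fun (xh yh : Var -> lterm) y => st y (xh y) yh).
  assert (PhiD : forall xh yh, lifts_assignment rho xh -> lifts_assignment rho yh ->
    lifts_assignment rho (Phi xh yh)).
  { intros xh yh Hx Hy y. unfold Phi.
    destruct (Hst y) as [[_ ->]|(s & b & L & q & (HL & _) & ->)]; auto.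
    apply HL. exact I. apply lift_subst with ar; auto. apply lift_emb. }
  assert (Phimono : forall xh xh' yh yh', lifts_assignment rho xh ->
    lifts_assignment rho xh' -> lifts_assignment rho yh -> lifts_assignment rho yh' ->
    le_assignment xh xh' -> le_assignment yh yh' ->
    le_assignment (Phi xh yh) (Phi xh' yh')).
  { intros xh xh' yh yh' Hx Hx' Hy Hy' Lx Ly y. unfold Phi.
    destruct (Hst y) as [[_ ->]|(s & b & L & q & (_ & HL & _) & ->)]; [apply Lx|].
    apply HL; try exact I; try (apply lift_subst with ar; auto; apply lift_emb).
    apply le_subst; auto. apply le_refl with (U := U) (p := s). apply lift_emb. }
  assert (refl : forall xh, lifts_assignment rho xh -> le_assignment xh xh).
  { intros xh Hx x. apply le_refl with (U := U) (p := rho x). auto. }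
  destruct (@fun_choice (Var -> lterm) (Var -> lterm) (fun xh m =>
    lifts_assignment rho xh -> lifts_assignment rho m /\ Phi xh m = m /\
    forall b, lifts_assignment rho b -> le_assignment (Phi xh b) b ->
      le_assignment m b)) as [M HM].
  { intros xh. destruct (classic (lifts_assignment rho xh)) as [Hx|N].
    - destruct (@least_fixed_point _ (lifts_assignment rho) le_assignment (Phi xh))
        as [m Hm]; eauto.
      + intros x y z H K v. exact (le_trans (H v) (K v)).
      + intros x y H K. apply functional_extensionality. intros v.
        exact (le_antisym (H v) (K v)).
      + apply assignment_complete.
    - exists xh. tauto. }
  exists M. split; [|split].
  - intros xh Hx. destruct (HM xh Hx) as (Dm & Em & _). split; [auto|split].
    + intros y Ny. transitivity (Phi xh (M xh) y); [now rewrite Em|].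
      unfold Phi. destruct (Hst y) as [[_ ->]|(s & b & L & q & _)]; auto.
      now apply Ny in q.
    + intros s b y q.
      assert (E : pr2 (M xh y) = pr2 (Phi xh (M xh) y)) by now rewrite Em.
      rewrite E. unfold Phi.
      destruct (Hst y) as [[N _]|(s' & b' & L & q' & (HL & _) & ->)].
      { now apply N in q. }
      (* Targets are distinct, so the premise behind [st y] is the given one. *)
      pose proof (Hd _ _ q q' eq_refl) as E'. injection E' as <- <-.
      rewrite <- (pr2_subst_emb U U_closed). apply HL. exact I.
      apply lift_subst with ar; auto. apply lift_emb.
  (* [M xh'] is a prefixed point of [Phi xh], hence above its least one. *)
  - intros xh xh' Hx Hx' Hle. apply HM; auto; [now apply HM|].
    destruct (HM xh' Hx') as (Dm & Em & _). rewrite <- Em at 2.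
    apply Phimono; auto.
  (* The atom-free assignment is a prefixed point for itself as parameter. The least solution lies
     below it, and atom-free terms are minimal. *)
  - assert (H0 : lifts_assignment rho (fun x => emb (rho x))) by (intros x; apply lift_emb).
    destruct (HM _ H0) as (Dm & _ & Lm).
    apply functional_extensionality. intros x. apply le_emb_inv with ar.
    refine (Lm _ H0 _ x). intros y. unfold Phi.
    destruct (Hst y) as [[_ ->]|(s & b & L & q & (_ & _ & HL) & ->)].
    + exact (refl _ H0 y).
    + rewrite emb_subst, HL. exact (refl _ H0 y).
Qed.

(** A lift [u] of [rho x] is stored at [x], the premises are solved, and the target is instantiated
    with the solution. As [x] is no premise target, the solution keeps [u] there. The root of [u] is
    never inspected, so atoms are covered. *)
Lemma liftable_tyxt r x a t rho :
  R r -> (forall x, closed ar (rho x)) -> concl r = (tvar x, a, t) ->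
  (forall s b u, prem r (s, b, u) -> liftable any (subst s rho) b (subst u rho)) ->
  liftable any (rho x) a (subst t rho).
Proof.
  intros Hr Hrho E IH. pose proof (HR Hr) as T. unfold tyft_tyxt in T. rewrite E in T.
  destruct T as (_ & _ & _ & Hy & Hd & _).
  destruct (@solve_premises (prem r) rho) as (M & HM & HMm & HM0).
  { intros s b u Hp. destruct (Hy _ _ _ Hp) as (y & -> & _). exists y. split; auto.
    apply (IH _ _ _ Hp). }
  { exact Hd. }
  set (up := fun (u : lterm) y => if PeanoNat.Nat.eq_dec x y then u else emb (rho y)).
  assert (Hup : forall u, lift U (rho x) u -> lifts_assignment rho (up u)).
  { intros u Hu y. unfold up. destruct (PeanoNat.Nat.eq_dec x y) as [<-|]; auto.
    apply lift_emb. }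
  exists (fun u => subst (emb t) (M (up u))). split; [|split].
  - intros u _ Hu. destruct (HM _ (Hup u Hu)) as (D & Efix & Hpr). split.
    + apply lift_subst with ar; auto. apply lift_emb.
    + rewrite (pr2_subst_emb U U_closed).
      replace (pr2 u) with (subst (tvar x) (fun z => pr2 (M (up u) z))).
      * apply pr_rule with r; auto.
        -- intros z. eapply closed_pr2; eauto.
        -- intros s b v Hp. destruct (Hy _ _ _ Hp) as (y & -> & _). simpl. auto.
      * simpl. rewrite Efix.
        -- unfold up. destruct (PeanoNat.Nat.eq_dec x x); congruence.
        -- intros s b Hp. destruct (Hy _ _ _ Hp) as (y & Ey & Nf). injection Ey as ->.
           apply Nf. constructor.
  - intros u u' _ _ Hu Hu' Hle. apply le_subst.
    + apply le_refl with (U := U) (p := t). apply lift_emb.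
    + apply HMm; auto. intros y. unfold up.
      destruct (PeanoNat.Nat.eq_dec x y); auto.
      apply le_refl with (U := U) (p := rho y). apply lift_emb.
  - replace (up (emb (rho x))) with (fun y => emb (rho y)).
    + rewrite HM0. apply emb_subst.
    + apply functional_extensionality. intros y. unfold up.
      destruct (PeanoNat.Nat.eq_dec x y); congruence.
Qed.

(** * Rules with a function symbol in the source *)

Fixpoint assign (xs : list Var) (ts : list lterm) (d : Var -> lterm) (x : Var) : lterm :=
  match xs, ts with
  | y :: xs, t :: ts => if PeanoNat.Nat.eq_dec y x then t else assign xs ts d x
  | _, _ => d x
  end.

Lemma map_assign xs : forall ts d, NoDup xs -> length xs = length ts ->
  map (assign xs ts d) xs = ts.
Proof.
  induction xs as [|x xs IH]; intros [|t ts] d Hn E; try discriminate; auto.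
  inversion Hn; subst. simpl. destruct (PeanoNat.Nat.eq_dec x x); [|congruence]. f_equal.
  transitivity (map (assign xs ts d) xs); auto. apply map_ext_in. intros y Hy.
  simpl. destruct (PeanoNat.Nat.eq_dec x y); congruence.
Qed.

Lemma assign_ind (r : Var -> lterm -> Prop) xs : forall ts d,
  (forall i x t, nth_error xs i = Some x -> nth_error ts i = Some t -> r x t) ->
  (forall x, r x (d x)) -> forall x, r x (assign xs ts d x).
Proof.
  induction xs as [|y xs IH]; intros [|t ts] d H Hd x; simpl; auto.
  destruct (PeanoNat.Nat.eq_dec y x) as [<-|].
  - now apply (H 0).
  - apply IH; auto. intros i. apply (H (S i)).
Qed.

Lemma assign_le xs : forall ts ts' d,
  length ts = length ts' ->
  (forall i t t', nth_error ts i = Some t -> nth_error ts' i = Some t' -> le ar t t') ->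
  (forall x, le ar (d x) (d x)) ->
  forall x, le ar (assign xs ts d x) (assign xs ts' d x).
Proof.
  induction xs as [|y xs IH]; intros [|t ts] [|t' ts'] d E H Hd x; try discriminate;
    simpl; auto.
  destruct (PeanoNat.Nat.eq_dec y x) as [<-|].
  - now apply (H 0).
  - apply IH; auto. intros i. apply (H (S i)).
Qed.

Lemma assign_map xs (d : Var -> lterm) x : assign xs (map d xs) d x = d x.
Proof.
  induction xs as [|y xs IH]; simpl; auto.
  destruct (PeanoNat.Nat.eq_dec y x); congruence.
Qed.

(** As for a variable source, but the arguments of the lift are stored at [xs]. The root [f] must be
    visible, whence [non_atomic], and [xs] must be distinct for the arguments to be read back. *)
Lemma liftable_tyft r f xs a t rho :
  R r -> (forall x, closed ar (rho x)) -> concl r = (tapp f (map tvar xs), a, t) ->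
  NoDup xs ->
  (forall s b u, prem r (s, b, u) -> liftable any (subst s rho) b (subst u rho)) ->
  liftable non_atomic (tapp f (map rho xs)) a (subst t rho).
Proof.
  intros Hr Hrho E Hn IH. pose proof (HR Hr) as T. unfold tyft_tyxt in T. rewrite E in T.
  destruct T as (_ & _ & _ & Hy & Hd & _).
  destruct (@solve_premises (prem r) rho) as (M & HM & HMm & HM0).
  { intros s b u Hp. destruct (Hy _ _ _ Hp) as (y & -> & _). exists y. split; auto.
    apply (IH _ _ _ Hp). }
  { exact Hd. }
  set (args := fun u : lterm => match u with tapp _ ts => ts | _ => [] end).
  set (up := fun (u : lterm) => assign xs (args u) (fun y => emb (rho y))).
  assert (Hform : forall u, non_atomic u -> lift U (tapp f (map rho xs)) u ->
    u = tapp (inl f) (args u) /\ length xs = length (args u) /\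
    lifts_assignment rho (up u)).
  { intros u Nu Hu. inversion Hu as [|f' ps ts D H| |p q]; subst.
    - simpl. repeat split; auto.
      + apply same_dom_length in D. now rewrite length_map in D.
      + intros x. apply (assign_ind (fun x t => lift U (rho x) t)); [|intros; apply lift_emb].
        intros i y v Ey Ev. apply (H i); auto. rewrite nth_error_map, Ey. auto.
    - now destruct (Nu q). }
  exists (fun u => subst (emb t) (M (up u))). split; [|split].
  - intros u Nu Hu. destruct (Hform u Nu Hu) as (Eu & El & Hup).
    destruct (HM _ Hup) as (D & Efix & Hpr). split.
    + apply lift_subst with ar; auto. apply lift_emb.
    + rewrite (pr2_subst_emb U U_closed).
      replace (pr2 u) with (subst (tapp f (map tvar xs)) (fun z => pr2 (M (up u) z))).
      * apply pr_rule with r; auto.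
        -- intros z. eapply closed_pr2; eauto.
        -- intros s b v Hp. destruct (Hy _ _ _ Hp) as (y & -> & _). simpl. auto.
      * transitivity (pr2 (tapp (inl f) (args u))); [|now rewrite <- Eu].
        simpl. f_equal. rewrite map_map. simpl.
        rewrite <- (@map_assign xs (args u) (fun y => emb (rho y))); auto.
        rewrite map_map. apply map_ext_in. intros x Hx. f_equal. apply Efix.
        intros s b Hp. destruct (Hy _ _ _ Hp) as (y & Ey & Nf). injection Ey as ->.
        apply Nf. apply free_app with (tvar y); [|constructor].
        now apply in_map.
  - intros u u' Nu Nu' Hu Hu' Hle.
    destruct (Hform u Nu Hu) as (Eu & El & Hup).
    destruct (Hform u' Nu' Hu') as (Eu' & El' & Hup').
    apply le_subst.
    + apply le_refl with (U := U) (p := t). apply lift_emb.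
    + apply HMm; auto. intros y. apply assign_le.
      * congruence.
      * rewrite Eu, Eu' in Hle. inversion Hle; subst; auto.
      * intros x. apply le_refl with (U := U) (p := rho x). apply lift_emb.
  - replace (up (emb (tapp f (map rho xs)))) with (fun y => emb (rho y)).
    + rewrite HM0. apply emb_subst.
    + apply functional_extensionality. intros y. unfold up. simpl.
      rewrite map_map. now rewrite assign_map.
Qed.

(** A non-atomic lift [trec _ T] is unfolded as a lifted term, and the lifting given for the
    unfolding of [trec X S] is applied to the result. *)
Lemma liftable_rec X S tX a p' :
  closed ar (trec X S) -> S X = Some tX ->
  liftable any (subst tX (recsub S)) a p' ->
  liftable non_atomic (trec X S) a p'.
Proof.
  intros Hc E (L & H1 & H2 & H3).
  (* The default [tvar X] is never reached on lifts: there [T] has the domain of [S], which contains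
     [X]. *)
  set (body := fun T : Var -> option lterm =>
    match T X with Some u => subst u (recsub T) | None => tvar X end).
  set (L' := fun t : lterm => match t with trec _ T => L (body T) | _ => t end).
  assert (Hrs : forall T, same_dom S T -> pointwise (lift U) S T ->
    forall x, lift U (recsub S x) (recsub T x)).
  { intros T D H x. unfold recsub. pose proof (D x) as Dx.
    destruct (S x), (T x); try (exfalso; intuition congruence); constructor; auto. }
  assert (Hbody : forall T, same_dom S T -> pointwise (lift U) S T ->
    lift U (subst tX (recsub S)) (body T)).
  { intros T D H. unfold body. destruct (same_dom_some _ D E) as [u Eu]. rewrite Eu.
    apply lift_subst with ar; auto. apply (H X); auto. }
  exists L'. split; [|split].
  - intros t Nt Ht. inversion Ht as [| |X' P T D H|p q]; subst; [|now destruct (Nt q)].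
    simpl. destruct (H1 _ I (Hbody T D H)) as [K1 K2]. split; auto.
    destruct (same_dom_some _ D E) as [u Eu].
    apply pr_rec with (pr2 u).
    + apply (closed_pr2 U_closed Ht Hc).
    + now rewrite Eu.
    + unfold body in K2 at 1. rewrite Eu in K2.
      rewrite (pr2_subst U_closed (H X tX u E Eu)) in K2.
      replace (recsub (fun Y => option_map (@pr2 F) (T Y))) with (fun x => pr2 (recsub T x)); auto.
      apply functional_extensionality. intros Z. unfold recsub. now destruct (T Z).
  - intros t t' Nt Nt' Ht Ht' Hle.
    inversion Ht as [| |X' P T D H|p q]; subst; [|now destruct (Nt q)].
    inversion Ht' as [| |X' P T' D' H'|p q]; subst; [|now destruct (Nt' q)].
    simpl. apply H2; try exact I; auto.
    inversion Hle as [| |X' T1 T2 D2 HT| |]; subst. unfold body.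
    destruct (same_dom_some _ D E) as [u Eu]. destruct (same_dom_some _ D' E) as [u' Eu'].
    rewrite Eu, Eu'. apply le_subst; eauto. intros x. unfold recsub. pose proof (D2 x) as Dx.
    destruct (T x), (T' x); try (exfalso; intuition congruence); constructor; auto.
  - simpl. unfold body. rewrite E. simpl. rewrite <- H3. f_equal.
    rewrite <- emb_recsub. apply emb_subst.
Qed.

(** The two hypotheses isolate what depends on the choice of [U]: how an atom matches a transition.
    They may use the non-atomic lifting of that transition, and [step_rec] also the lifting for the
    unfolding. *)
Hypothesis step_app : forall f ps a p',
  liftable non_atomic (tapp f ps) a p' -> proves ar R (tapp f ps) a p' ->
  atom_step (tapp f ps) a p'.
Hypothesis step_rec : forall X S tX a p',
  S X = Some tX -> liftable any (subst tX (recsub S)) a p' ->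
  liftable non_atomic (trec X S) a p' -> proves ar R (trec X S) a p' ->
  atom_step (trec X S) a p'.

(** Induction on the proof. A tyxt rule covers atoms at once; otherwise the non-atomic lifting is
    completed by [step_app] or [step_rec]. *)
Theorem proves_liftable p a p' : proves ar R p a p' -> liftable any p a p'.
Proof.
  induction 1 as [r sg s a t Hr Hsg E Hp IH|X S tX a q Hc E Hp IH].
  - pose proof (HR Hr) as T. unfold tyft_tyxt in T. rewrite E in T.
    destruct T as (_ & _ & _ & _ & _ & [[x ->]|(f & xs & _ & Hn & ->)]).
    + simpl. eapply liftable_tyxt; eauto.
    + assert (Es : subst (tapp f (map tvar xs)) sg = tapp f (map sg xs)).
      { simpl. f_equal. now rewrite map_map. }
      assert (P : proves ar R (tapp f (map sg xs)) a (subst t sg)).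
      { rewrite <- Es. eapply pr_rule; eauto. }
      rewrite Es. assert (L : liftable non_atomic (tapp f (map sg xs)) a (subst t sg)).
      { eapply liftable_tyft; eauto. }
      apply liftable_combine; auto.
  - assert (L : liftable non_atomic (trec X S) a q) by (eapply liftable_rec; eauto).
    apply liftable_combine; auto. apply step_rec with tX; auto.
    eapply pr_rec; eauto.
Qed.

End Transitions.
Arguments any {F} t.
Arguments non_atomic {F} t.

(** * Bisimilarity *)

Inductive context_closure (F : Type) (U : term F -> term F -> Prop) :
  term F -> term F -> Prop :=
| cc_var x : context_closure U (tvar x) (tvar x)
| cc_app f ps qs :
    same_dom (nth_error ps) (nth_error qs) ->
    (forall i p q, nth_error ps i = Some p -> nth_error qs i = Some q ->
       context_closure U p q) ->
    context_closure U (tapp f ps) (tapp f qs)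
| cc_rec X P Q :
    same_dom P Q ->
    (forall i p q, P i = Some p -> Q i = Some q -> context_closure U p q) ->
    context_closure U (trec X P) (trec X Q)
| cc_base p q : U p q -> context_closure U p q.

Lemma context_closure_sym (F : Type) (U V : term F -> term F -> Prop) p q :
  (forall p q, U p q -> V q p) -> context_closure U p q -> context_closure V q p.
Proof.
  intros H. induction 1; try (constructor; eauto using same_dom_sym; fail).
Qed.

Lemma lift_context_closure (F : Type) (U : term F -> term F -> Prop) p t :
  lift U p t -> context_closure U p (pr2 t).
Proof.
  induction 1 as [x|f ps ts D H IH|X P T D H IH|p q HU]; simpl.
  - constructor.
  - constructor.
    + apply same_dom_trans with (T := nth_error ts); auto. apply same_dom_map.
    + intros i p q Ep Eq. rewrite nth_error_map in Eq.
      destruct (nth_error ts i) eqn:Et; [|discriminate]. injection Eq as <-. eauto.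
  - constructor.
    + apply same_dom_trans with (T := T); auto. apply same_dom_option_map.
    + intros i p q Ep Eq. destruct (T i) eqn:Et; [|discriminate]. injection Eq as <-. eauto.
  - now constructor.
Qed.

(** Converse of [lift_context_closure]: the places where [cc_base] applies become atoms. *)
Lemma context_closure_lift (F : Type) (U : term F -> term F -> Prop) p q :
  context_closure U p q -> exists t, lift U p t /\ pr2 t = q.
Proof.
  induction 1 as [x|f ps qs D H IH|X P Q D H IH|p q HU].
  - exists (tvar x). split; [constructor|auto].
  - destruct (option_fun_choice (nth_error ps) (fun i p t =>
      lift U p t /\ nth_error qs i = Some (pr2 t))) as (T & DT & HT).
    { intros i p Ep. destruct (same_dom_some _ D Ep) as [q Eq].
      destruct (IH i p q Ep Eq) as (t & Ht & <-). eauto. }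
    destruct (list_of_fun _ DT) as [ts <-]. exists (tapp (inl f) ts). split.
    + constructor; auto. intros i p t Ep Et. now apply (HT i).
    + simpl. f_equal. apply nth_error_inj, option_fun_ext.
      * apply same_dom_trans with (T := nth_error ts); [apply same_dom_sym, same_dom_map|].
        apply same_dom_trans with (T := nth_error ps); auto using same_dom_sym.
      * intros i u q Eu Eq. rewrite nth_error_map in Eu.
        destruct (nth_error ts i) as [t|] eqn:Et; [|discriminate]. injection Eu as <-.
        destruct (same_dom_some _ (same_dom_sym DT) Et) as [p Ep].
        destruct (HT i p t Ep Et) as [_ E]. congruence.
  - destruct (option_fun_choice P (fun i p t =>
      lift U p t /\ Q i = Some (pr2 t))) as (T & DT & HT).
    { intros i p Ep. destruct (same_dom_some _ D Ep) as [q Eq].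
      destruct (IH i p q Ep Eq) as (t & Ht & <-). eauto. }
    exists (trec X T). split.
    + constructor; auto. intros i p t Ep Et. now apply (HT i).
    + simpl. f_equal. apply option_fun_ext.
      * apply same_dom_trans with (T := T); [apply same_dom_sym, same_dom_option_map|].
        apply same_dom_trans with (T := P); auto using same_dom_sym.
      * intros i u q Eu Eq.
        destruct (T i) as [t|] eqn:Et; [|discriminate]. injection Eu as <-.
        destruct (same_dom_some _ (same_dom_sym DT) Et) as [p Ep].
        destruct (HT i p t Ep Et) as [_ E]. congruence.
  - exists (atom q). split; [now constructor|auto].
Qed.

(** Each pair at an atom factors through a middle term; filling these into the context gives the
    middle term of the whole. *)
Lemma lift_decompose (F : Type) (U V W : term F -> term F -> Prop) p t :
  (forall p q, U p q -> exists m, context_closure V p m /\ W q m) ->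
  lift U p t ->
  exists m, context_closure V p m /\ context_closure W (pr2 t) m.
Proof.
  intros HU. induction 1 as [x|f ps ts D H IH|X P T D H IH|p q Hq].
  - exists (tvar x). split; constructor.
  - destruct (option_fun_choice (nth_error ps) (fun i p m =>
      context_closure V p m /\
      forall t, nth_error ts i = Some t -> context_closure W (pr2 t) m))
      as (M & DM & HM).
    { intros i p Ep. destruct (same_dom_some _ D Ep) as [u Eu].
      destruct (IH i p u Ep Eu) as (m & H1 & H2). exists m. split; auto.
      intros u' Eu'. rewrite Eu in Eu'. injection Eu' as <-. exact H2. }
    destruct (list_of_fun _ DM) as [ms <-]. exists (tapp f ms). split.
    + constructor; auto. intros i p m Ep Em. apply (HM i p m Ep Em).
    + simpl. constructor.
      * apply same_dom_trans with (T := nth_error ts); [apply same_dom_sym, same_dom_map|].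
        apply same_dom_trans with (T := nth_error ps); auto using same_dom_sym.
      * intros i u m Eu Em. rewrite nth_error_map in Eu.
        destruct (nth_error ts i) as [v|] eqn:Ev; [|discriminate]. injection Eu as <-.
        destruct (same_dom_some _ (same_dom_sym D) Ev) as [p Ep].
        apply (HM i p m Ep Em); auto.
  - destruct (option_fun_choice P (fun i p m =>
      context_closure V p m /\
      forall t, T i = Some t -> context_closure W (pr2 t) m))
      as (M & DM & HM).
    { intros i p Ep. destruct (same_dom_some _ D Ep) as [u Eu].
      destruct (IH i p u Ep Eu) as (m & H1 & H2). exists m. split; auto.
      intros u' Eu'. rewrite Eu in Eu'. injection Eu' as <-. exact H2. }
    exists (trec X M). split.
    + constructor; auto. intros i p m Ep Em. apply (HM i p m Ep Em).
    + simpl. constructor.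
      * apply same_dom_trans with (T := T); [apply same_dom_sym, same_dom_option_map|].
        apply same_dom_trans with (T := P); auto using same_dom_sym.
      * intros i u m Eu Em.
        destruct (T i) as [v|] eqn:Ev; [|discriminate]. injection Eu as <-.
        destruct (same_dom_some _ (same_dom_sym D) Ev) as [p Ep].
        apply (HM i p m Ep Em); auto.
  - destruct (HU p q Hq) as (m & H1 & H2). exists m. split; [exact H1|].
    now apply cc_base.
Qed.

(** * Bisimilarity as an equivalence, and its preservation by contexts *)

Section Bisimilarity.
Variables (F A : Type) (ar : F -> nat) (R : rule F A -> Prop).
Hypothesis HR : forall r, R r -> tyft_tyxt ar r.
Notation "p ~~ q" := (bisimilar ar R p q) (at level 70).

Lemma bisimilar_closed p q : p ~~ q -> closed ar p /\ closed ar q.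
Proof. intros (B & HB & H). now apply HB. Qed.

Lemma bisimilar_refl p : closed ar p -> p ~~ p.
Proof.
  intros Hp. exists (fun p q => p = q /\ closed ar p). split; auto. repeat split.
  - apply H.
  - apply H.
  - destruct H as [<- [W _]]. apply W.
  - destruct H as [<- [_ N]]. apply N.
  - symmetry. apply H.
  - destruct H as [<- [W _]]. apply W.
  - destruct H as [<- [_ N]]. apply N.
  - intros q1 q2 a q' [<- Hc] P. exists q'. repeat split; auto;
    apply (proves_closed HR) in P; apply P.
Qed.

Lemma bisimilar_sym p q : p ~~ q -> q ~~ p.
Proof. intros (B & HB & H). exists B. split; auto. now apply HB. Qed.

Lemma bisimilar_step p q a p' : p ~~ q -> proves ar R p a p' ->
  exists q', proves ar R q a q' /\ p' ~~ q'.
Proof.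
  intros (B & HB & H) P. destruct HB as (H1 & H2 & H3).
  destruct (H3 _ _ _ _ H P) as (q' & Q & K). exists q'. split; auto.
  exists B. split; auto. split; auto.
Qed.

Lemma bisimilar_trans p q r : p ~~ q -> q ~~ r -> p ~~ r.
Proof.
  intros H K. exists (fun p r => exists q, p ~~ q /\ q ~~ r). split; eauto.
  split; [|split].
  - intros p1 p2 (p3 & H1 & H2). apply bisimilar_closed in H1, H2. tauto.
  - intros p1 p2 (p3 & H1 & H2). exists p3. split; now apply bisimilar_sym.
  - intros p1 p2 a p1' (p3 & H1 & H2) P.
    destruct (bisimilar_step H1 P) as (p3' & P3 & K1).
    destruct (bisimilar_step H2 P3) as (p2' & P2 & K2). eauto.
Qed.

(** On closed terms the contextual closure of bisimilarity is a bisimulation: transitions are lifted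
    along bisimilarity, where an atom answers by its own matching transition and leads to an atom
    again. *)
Lemma lean_congruence p q :
  closed ar p -> context_closure (bisimilar ar R) p q -> p ~~ q.
Proof.
  intros Hp H.
  exists (fun p q => closed ar p /\ closed ar q /\ context_closure (bisimilar ar R) p q).
  split; [split; [|split]|].
  - tauto.
  - intros p1 p2 (H1 & H2 & H3). repeat split; try apply H1; try apply H2.
    revert H3. apply context_closure_sym, bisimilar_sym.
  - intros p1 p2 a p1' (H1 & H2 & H3) P.
    destruct (context_closure_lift H3) as (t & Ht & <-).
    destruct (proves_liftable HR (U := bisimilar ar R) bisimilar_closed) with (3 := P)
      as (L & HL & _).
    + intros f ps b p' _ P' q' Hq. destruct (bisimilar_step Hq P') as (q'' & Q & K).
      exists (atom q''). split; auto. now constructor.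
    + intros X S tX b p' _ _ _ P' q' Hq. destruct (bisimilar_step Hq P') as (q'' & Q & K).
      exists (atom q''). split; auto. now constructor.
    + destruct (HL t I Ht) as [K1 K2]. exists (pr2 (L t)). split; auto.
      split; [apply (proves_closed HR P)|]. split; [apply (proves_closed HR K2)|].
      now apply lift_context_closure.
  - split; auto. split; auto.
    destruct (context_closure_lift H) as (t & Ht & <-).
    apply (closed_pr2 bisimilar_closed Ht Hp).
Qed.

(** * Two recursive specifications with pairwise bisimilar bodies *)

Section Recursion.
Variables S S' : Var -> option (term F).

Definition rec_pair (p q : term F) : Prop :=
  exists Y, inV S Y /\ p = trec Y S /\ q = trec Y S'.

(* Bisimilarity is composed on the right only: the induction on the proof of a
   transition of [p] does not survive replacing [p] by a bisimilar term. *)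
Inductive rec_sim : term F -> term F -> Prop :=
| rec_sim_pair Y q :
    inV S Y -> closed ar (trec Y S) -> trec Y S' ~~ q -> rec_sim (trec Y S) q
| rec_sim_lift p t q :
    closed ar p -> lift rec_sim p t -> non_atomic t -> pr2 t ~~ q -> rec_sim p q.

Lemma rec_sim_closed p q : rec_sim p q -> closed ar p /\ closed ar q.
Proof. destruct 1; split; auto; eapply bisimilar_closed; eauto. Qed.

Lemma rec_sim_trans p q r : rec_sim p q -> q ~~ r -> rec_sim p r.
Proof.
  destruct 1 as [Y q HY Hc H|p t q Hc Ht Nt H]; intros K.
  - apply rec_sim_pair; auto. eapply bisimilar_trans; eauto.
  - apply rec_sim_lift with t; auto. eapply bisimilar_trans; eauto.
Qed.

(** Dispenses with [non_atomic]: an atom already holds a pair of [rec_sim], which absorbs the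
    bisimilarity on its right. *)
Lemma rec_sim_of_lift p t q : closed ar p -> lift rec_sim p t -> pr2 t ~~ q -> rec_sim p q.
Proof.
  intros Hc Ht H. destruct (classic (exists q, t = atom q)) as [[q' ->]|N].
  - inversion Ht; subst. eapply rec_sim_trans; eauto.
  - apply rec_sim_lift with t; auto. intros q' E. eauto.
Qed.

(** An induction principle that reaches the pairs nested in [lift rec_sim p t], by recursion through
    [lift_mono]. *)
Lemma rec_sim_nested_ind (P : term F -> term F -> Prop) :
  (forall Y q, inV S Y -> closed ar (trec Y S) -> trec Y S' ~~ q -> P (trec Y S) q) ->
  (forall p t q, closed ar p -> lift P p t -> pr2 t ~~ q -> P p q) ->
  forall p q, rec_sim p q -> P p q.
Proof.
  intros Hp Hl. fix IH 3. intros p q [Y q1 HY Hc HB|p1 t q1 Hc Ht Nt HB].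
  - auto.
  - apply Hl with t; auto. exact (lift_mono P IH Ht).
Qed.

(** The bisimilarities used at inner levels are merged into a single one on the right, by
    [lean_congruence]. *)
Lemma rec_sim_decompose p q :
  rec_sim p q -> exists m, context_closure rec_pair p m /\ q ~~ m.
Proof.
  revert p q. apply rec_sim_nested_ind.
  - intros Y q HY Hc HB. exists (trec Y S'). split; [|now apply bisimilar_sym].
    apply cc_base. exists Y. auto.
  - intros p t q Hc Ht HB. destruct (@lift_decompose _ _ rec_pair (bisimilar ar R) p t (fun _ _ H => H) Ht) as (m & H1 & H2).
    exists m. split; auto. apply bisimilar_trans with (pr2 t).
    + now apply bisimilar_sym.
    + apply lean_congruence; auto. apply (bisimilar_closed HB).
Qed.

Hypothesis dom_eq : same_dom S S'.
Hypothesis rec_closed : forall Y, inV S Y -> closed ar (trec Y S).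
Hypothesis rec_closed' : forall Y, inV S' Y -> closed ar (trec Y S').
Hypothesis bodies : forall Y t t', S Y = Some t -> S' Y = Some t' ->
  subst t (recsub S') ~~ subst t' (recsub S').

Lemma inV_eq Y : inV S Y <-> inV S' Y.
Proof. unfold inV. now rewrite (dom_eq Y). Qed.

(** A pair built by [rec_sim_lift] comes with a non-atomic lift, to which the lifting built so far
    applies. A pair built by [rec_sim_pair] is served by the lifting for the unfolding. *)
Lemma rec_sim_step p a p' :
  proves ar R p a p' -> liftable ar R rec_sim any p a p'.
Proof.
  assert (Hl : forall p a p' t q, lift rec_sim p t -> non_atomic t -> pr2 t ~~ q ->
    liftable ar R rec_sim non_atomic p a p' -> proves ar R p a p' ->
    exists t, lift rec_sim p' t /\ proves ar R q a (pr2 t)).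
  { intros p1 b p1' t q Ht Nt HB (L & HL & _) P. destruct (HL t Nt Ht) as [K1 K2].
    destruct (bisimilar_step HB K2) as (q' & Q & K). exists (atom q'). split; auto.
    constructor. eapply rec_sim_of_lift; eauto. eapply proves_closed; eauto. }
  apply proves_liftable; auto using rec_sim_closed.
  - intros f ps b p1' HL P q Hq. inversion Hq as [|p1 t q1 Hc Ht Nt HB]; subst. eauto.
  - intros X T tX b p1' ET HL HN P q Hq.
    inversion Hq as [Y q1 HY Hc HB|p1 t q1 Hc Ht Nt HB]; subst; eauto.
    destruct (same_dom_some _ dom_eq ET) as [tX' ET'].
    (* A lift of [recsub S] that replaces each [trec Z S] by the atom for [trec Z S'], so that it
       projects to [recsub S']. *)
    set (k := fun Z => match S' Z with Some _ => atom (trec Z S') | None => tvar Z end).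
    assert (Hk : forall x, lift rec_sim (recsub S x) (k x)).
    { intros x. unfold recsub, k. pose proof (dom_eq x) as Dx.
      destruct (S x) eqn:Ex, (S' x) eqn:Ex'; try (exfalso; intuition congruence);
        constructor.
      assert (inV S x) by (unfold inV; congruence).
      apply rec_sim_pair; auto. apply bisimilar_refl, rec_closed'. now apply inV_eq. }
    destruct HL as (L & HL & _).
    destruct (HL (subst (emb tX) k) I) as [K1 K2].
    { eapply lift_subst; eauto using rec_sim_closed. apply lift_emb. }
    rewrite (pr2_subst_emb _ rec_sim_closed) in K2.
    replace (fun x => pr2 (k x)) with (recsub S') in K2.
    2: { apply functional_extensionality. intros x. unfold recsub, k. now destruct (S' x). }
    (* The passage from the body in [S] to the body in [S'], both instantiated with [recsub S'];
       folding and [HB] then lead to [q]. *)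
    destruct (bisimilar_step (bodies ET ET') K2) as (q1 & Q1 & B1).
    assert (Q2 : proves ar R (trec X S') b q1).
    { apply pr_rec with tX'; auto. apply rec_closed'. now apply inV_eq. }
    destruct (bisimilar_step HB Q2) as (q2 & Q3 & B2).
    exists (atom q2). split; auto. constructor.
    eapply rec_sim_of_lift; eauto using bisimilar_trans. eapply proves_closed; eauto.
Qed.

(** The lifting along [rec_sim] gives the matching transition; decomposing its target returns to
    [rec_pair], at the price of a bisimilarity. *)
Lemma rec_pair_step p q a p' :
  closed ar p -> context_closure rec_pair p q -> proves ar R p a p' ->
  exists m q', context_closure rec_pair p' m /\ proves ar R q a q' /\ q' ~~ m.
Proof.
  intros Hp H P. destruct (context_closure_lift H) as (t & Ht & <-).
  assert (Ht' : lift rec_sim p t).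
  { revert Ht. apply lift_mono. intros p1 q1 (Y & HY & -> & ->).
    apply rec_sim_pair; auto. apply bisimilar_refl, rec_closed'. now apply inV_eq. }
  destruct (rec_sim_step P) as (L & HL & _). destruct (HL t I Ht') as [K1 K2].
  destruct (@lift_decompose _ _ rec_pair (bisimilar ar R) _ _ rec_sim_decompose K1) as (m & M1 & M2). exists m, (pr2 (L t)).
  repeat split; auto. apply lean_congruence; auto. eapply proves_closed; eauto.
Qed.

End Recursion.

(** Bisimilarity is allowed on the left as well, since the induction on proofs is already completed
    in [rec_sim_step]. *)
Definition rec_bisim S S' (p q : term F) : Prop :=
  exists p1 q1, p ~~ p1 /\ context_closure (rec_pair S S') p1 q1 /\ q1 ~~ q.

Lemma rec_bisim_sym S S' p q : same_dom S S' -> rec_bisim S S' p q -> rec_bisim S' S q p.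
Proof.
  intros D (p1 & q1 & H1 & H2 & H3). exists q1, p1.
  split; [now apply bisimilar_sym|]. split; [|now apply bisimilar_sym].
  revert H2. apply context_closure_sym. intros p2 q2 (Y & HY & -> & ->).
  exists Y. split; auto. now apply (inV_eq D).
Qed.

Lemma rec_bisim_step S S' :
  same_dom S S' ->
  (forall Y, inV S Y -> closed ar (trec Y S)) ->
  (forall Y, inV S' Y -> closed ar (trec Y S')) ->
  (forall Y t t', S Y = Some t -> S' Y = Some t' ->
    subst t (recsub S') ~~ subst t' (recsub S')) ->
  forall p q a p', rec_bisim S S' p q -> proves ar R p a p' ->
  exists q', proves ar R q a q' /\ rec_bisim S S' p' q'.
Proof.
  intros D C C' HB p q a p' (p1 & q1 & H1 & H2 & H3) P.
  destruct (bisimilar_step H1 P) as (p1' & P1 & B1).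
  destruct (rec_pair_step D C C' HB (proj2 (bisimilar_closed H1)) H2 P1)
    as (m & q1' & Hm & Q1 & B2).
  destruct (bisimilar_step H3 Q1) as (q' & Q & B3). exists q'. split; auto.
  exists p1', m. repeat split; auto. eauto using bisimilar_trans, bisimilar_sym.
Qed.

(** A symmetric relation takes [rec_bisim] in both orientations. One uses the body hypothesis at
    [recsub S'], the other the one at [recsub S], read backwards. *)
Lemma full_congruence_rec S S' X :
  same_dom S S' ->
  (forall Y, inV S Y -> closed ar (trec Y S)) ->
  (forall Y, inV S' Y -> closed ar (trec Y S')) ->
  (forall Y t t', S Y = Some t -> S' Y = Some t' ->
    subst t (recsub S) ~~ subst t' (recsub S)) ->
  (forall Y t t', S Y = Some t -> S' Y = Some t' ->
    subst t (recsub S') ~~ subst t' (recsub S')) ->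
  inV S X -> trec X S ~~ trec X S'.
Proof.
  intros D C C' HB HB' HX.
  exists (fun p q => rec_bisim S S' p q \/ rec_bisim S' S p q). split; [split; [|split]|].
  - intros p q [(p1 & q1 & H1 & _ & H2)|(p1 & q1 & H1 & _ & H2)];
      apply bisimilar_closed in H1, H2; tauto.
  - intros p q [H|H]; [right|left]; revert H; apply rec_bisim_sym; auto using same_dom_sym.
  - intros p q a p' [H|H] P.
    + destruct (rec_bisim_step D C C' HB' H P) as (q' & Q & K). eauto.
    + destruct (@rec_bisim_step S' S (same_dom_sym D) C' C) with (2 := H) (3 := P)
        as (q' & Q & K); eauto using bisimilar_sym.
  - left. exists (trec X S), (trec X S'). split; [|split].
    + now apply bisimilar_refl, C.
    + apply cc_base. exists X. auto.
    + apply bisimilar_refl, C'. now apply (inV_eq D).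
Qed.

End Bisimilarity.

Theorem mainTheorem7 (F A : Type) (ar : F -> nat) (R : rule F A -> Prop)
  (HR : forall r, R r -> tyft_tyxt ar r) :
  (* equivalence relation on T(Sigma) *)
  (forall p, closed ar p -> bisimilar ar R p p) /\
  (forall p q, bisimilar ar R p q -> bisimilar ar R q p) /\
  (forall p q r, bisimilar ar R p q -> bisimilar ar R q r -> bisimilar ar R p r) /\
  (* (1) congruence for function symbols *)
  (forall (f : F) (ps qs : list (term F)),
     length ps = ar f -> Forall2 (bisimilar ar R) ps qs ->
     bisimilar ar R (tapp f ps) (tapp f qs)) /\
  (* (2) congruence for recursion *)
  (forall (W : Var -> Prop) (X : Var) (S S' : Var -> option (term F)),
     W X ->
     (forall Y, W Y <-> inV S Y) -> (forall Y, W Y <-> inV S' Y) ->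
     (forall Y t, S Y = Some t -> wf ar t /\ forall x, free x t -> W x) ->
     (forall Y t, S' Y = Some t -> wf ar t /\ forall x, free x t -> W x) ->
     (forall Y t t' (sg : Var -> term F),
        W Y -> S Y = Some t -> S' Y = Some t' ->
        (forall Z, W Z -> closed ar (sg Z)) ->
        bisimilar ar R (subst t sg) (subst t' sg)) ->
     bisimilar ar R (trec X S) (trec X S')).
Proof.
  split; [exact (@bisimilar_refl F A ar R HR)|]. split; [exact (@bisimilar_sym _ _ _ _)|].
  split; [exact (@bisimilar_trans _ _ _ _)|]. split.
  - intros f ps qs El H. apply lean_congruence; auto.
    + split.
      * constructor; auto. intros t Ht. destruct (Forall2_in_l _ H Ht) as (q & _ & B).
        apply (bisimilar_closed B).
      * intros x Hx. inversion Hx as [|f' ts t Ht Hf|]; subst.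
        destruct (Forall2_in_l _ H Ht) as (q & _ & B).
        destruct (bisimilar_closed B) as [[_ N] _]. now apply N in Hf.
    + apply cc_app.
      * apply same_dom_length. eapply Forall2_length; eauto.
      (* The arity equation fixes the length of [ps] and would obstruct the induction. *)
      * clear El. induction H as [|p q ps qs B H IH]; intros [|i] p' q' E E'; simpl in *;
          try discriminate; eauto.
        injection E as <-. injection E' as <-. now apply cc_base.
  - intros W X S S' HX HS HS' HSw HSw' HB.
    (* [W] is both the domain of [T] and a bound on the free variables of its bodies, so all of them
       are bound. *)
    assert (Hclosed : forall T : Var -> option (term F), (forall Y, W Y <-> inV T Y) ->
      (forall Y t, T Y = Some t -> wf ar t /\ forall x, free x t -> W x) ->
      forall Y, inV T Y -> closed ar (trec Y T)).
    { intros T HT HTw Y HY. split.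
      - constructor; auto. intros Z t E. apply (HTw Z t E).
      - intros x Hx. inversion Hx as [| |X' T' Z t E Hf N]; subst.
        apply (HTw Z t E) in Hf. apply HT in Hf. now apply Hf. }
    assert (Hsub : forall T : Var -> option (term F), (forall Y, W Y <-> inV T Y) ->
      (forall Y t, T Y = Some t -> wf ar t /\ forall x, free x t -> W x) ->
      forall Z, W Z -> closed ar (recsub T Z)).
    { intros T HT HTw Z HZ. apply HT in HZ. unfold recsub. pose proof HZ as HZ'.
      unfold inV in HZ. destruct (T Z) eqn:E; [|congruence]. now apply (Hclosed T). }
    apply full_congruence_rec.
    + exact HR.
    + intros Y. pose proof (HS Y) as H1. pose proof (HS' Y) as H2. unfold inV in *.
      destruct (S Y), (S' Y); split; try congruence; intros _; exfalso; intuition congruence.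
    + apply (Hclosed S); auto.
    + apply (Hclosed S'); auto.
    (* The instances of [HB] at the substitutions [recsub S] and, next, [recsub S']. *)
    + intros Y t t' E E'. apply (HB Y); auto. apply HS. unfold inV. congruence.
    + intros Y t t' E E'. apply (HB Y); auto. apply HS. unfold inV. congruence.
    + now apply HS.
Qed.
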